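(* Let $\{Y_t\}_{t\ge1}$ be a $\beta$ARC process (as defined in the context) and let $\varphi:[0,1]\to\mathbb{R}$ be a measurable function such that $\mathbb{E}\big(\varphi(Y_t)^2\big)<\infty$ for all $t>0$. If $$\sum_{k=1}^\infty \frac{\sup_{t\ge1}\big|\mathrm{Cov}\big(\varphi(Y_t),\varphi(Y_{t+k})\big)\big|}{k^q}<\infty\quad\text{for some } 0\le q<1,$$ and $$\sum_{k=1}^\infty\frac{\mathrm{Var}\big(\varphi(Y_k)\big)\,(\ln k)^2}{k^2}<\infty,$$ then $$\lim_{n\to\infty}\frac1n\sum_{\ell=1}^{n}\Big[\varphi(Y_\ell)-\mathbb{E}\big(\varphi(Y_\ell)\big)\Big]=0\quad\text{almost surely.}$$
   Context: The $\beta$ARC$(p)$ process: let $\nu>0$, $\alpha\in\mathbb{R}$, $\boldsymbol\beta\in\mathbb{R}^l$, $\boldsymbol\phi=(\phi_1,\dots,\phi_p)'\in\mathbb{R}^p$; let $\{\boldsymbol{x}_t\}$ be $l$-dimensional exogenous (possibly random) covariates; let $T:[0,1]\to[0,1]$ be a Borel measurable map with $k$-fold composition $T^k$ ($T^0$ the identity), and $U_0$ a $(0,1)$-valued random variable with $T^t(U_0)\in(0,1)$ for all $t\ge0$ with probability $1$; let $g,h:(0,1)\to\mathbb{R}$ be twice continuously differentiable link functions. Let $\mathscr{F}_{t-1}$ be the $\sigma$-field generated by $U_0$, the covariates up to time $t$ and the values of $Y$ up to time $t-1$ (including initial values of $Y$ in $(0,1)$ and of the covariates at times $0,-1,\dots,1-p$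 if $p\ge1$). For each $t\ge1$, $\mu_t$ is an $\mathscr{F}_{t-1}$-measurable $(0,1)$-valued random variable satisfying $$g(\mu_t)=\alpha+\boldsymbol{x}_t'\boldsymbol\beta+\sum_{j=1}^p\phi_j\big(g(Y_{t-j})-\boldsymbol{x}_{t-j}'\boldsymbol\beta\big)+h\big(T^{t-1}(U_0)\big),$$ and, conditionally on $\mathscr{F}_{t-1}$, $Y_t$ has the beta density $$f(y;\mu_t,\nu\mid\mathscr{F}_{t-1})=\frac{\Gamma(\nu)}{\Gamma(\nu\mu_t)\Gamma(\nu(1-\mu_t))}\,y^{\nu\mu_t-1}(1-y)^{\nu(1-\mu_t)-1},\qquad 0<y<1.$$ The covariate and autoregressive terms may be absent; the case with $\mu_t=T^{t-1}(U_0)$ (the pure chaotic $\beta$ARC process) is included. *)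

(* Defs.v *)
From HB Require Import structures.
From mathcomp Require Import all_boot all_order all_algebra.
From mathcomp Require Import all_classical all_reals all_analysis.
Set Implicit Arguments.
Unset Strict Implicit.
Unset Printing Implicit Defensive.
Import Order.TTheory GRing.Theory Num.Theory.
Import numFieldNormedType.Exports.
Local Open Scope classical_set_scope.
Local Open Scope ring_scope.

(* Meaningful for [0 < a], where the integral converges. *)
Definition Gamma {R : realType} (a : R) : R :=
  \int[lebesgue_measure]_(s in `]0, +oo[) (s `^ (a - 1) * expR (- s)).

(* Mean/precision parametrization: this is the density of the Beta law with
   shape parameters [nu * mu] and [nu * (1 - mu)]. The library's [beta_pdf]
   only allows natural-number shape parameters. *)
Definition beta_density {R : realType} (nu mu : R) : R -> R :=
  (fun y => Gamma nu / (Gamma (nu * mu) * Gamma (nu * (1 - mu)))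
            * y `^ (nu * mu - 1) * (1 - y) `^ (nu * (1 - mu) - 1))
  \_ `]0, 1[.

Definition C2_on01 {R : realType} (f : R -> R) : Prop :=
  forall u : R, u \in `]0, 1[ ->
    [/\ derivable f u 1, derivable f^`()%classic u 1
      & {for u, continuous f^`(2)%classic}].

Section betaARC.
Context {d : measure_display} {Omega : measurableType d} {R : realType}.
Variable P : probability Omega R.

(* Generators of the sigma-field $\mathscr{F}_{t-1}$, the information available
   just before [Y t] is drawn: [U0], the covariates at times [1-p .. t] and the
   values of [Y] at times [1-p .. t-1]. The times [s <= 0] carry the initial
   values, of which there are none when [p = 0]. *)
Definition past_generators (p l : nat) (U0 : Omega -> R)
    (x : int -> 'I_l -> Omega -> R) (Y : int -> Omega -> R) (t : nat)
    : set (set Omega) :=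
  g_sigma_algebra_preimage U0
  `|` \bigcup_(s in [set s : int | 1 - p%:Z <= s <= t%:Z])
        \bigcup_i g_sigma_algebra_preimage (x s i)
  `|` \bigcup_(s in [set s : int | 1 - p%:Z <= s < t%:Z])
        g_sigma_algebra_preimage (Y s).

(* Functions on [0, 1] or (0, 1) (namely [T], [g] and [h]) are total functions
   on [R] of which only the restriction to that interval is constrained or,
   up to a null event, used. The coefficient of lag [j + 1] is [phi 0 j], for
   [j : 'I_p]. Taking [p = 0] or [l = 0] removes the autoregressive or the
   covariate terms; the pure chaotic process, whose conditional mean at time
   [t] is [iter t.-1 T U0], is [p = l = 0], [alpha = 0] and [g = h = id]. *)
Record betaARC (p l : nat) (nu alpha : R) (beta : 'rV[R]_l) (phi : 'rV[R]_p)
    (x : int -> 'I_l -> {RV P >-> R}) (T : R -> R) (U0 : {RV P >-> R})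
    (g h : R -> R) (mu : nat -> Omega -> R) (Y : int -> {RV P >-> R}) : Prop :=
  BetaARC {
    nu_gt0 : 0 < nu;
    T_itv : forall u : R, u \in `[0, 1] -> T u \in `[0, 1];
    T_measurable : measurable_fun (`[0, 1]%classic : set R) T;
    U0_itv : forall w, U0 w \in `]0, 1[;
    orbit_itv : {ae P, forall w, forall t : nat, iter t T (U0 w) \in `]0, 1[};
    g_C2 : C2_on01 g;
    h_C2 : C2_on01 h;
    Y_itv : forall (s : int) w, 1 - p%:Z <= s -> Y s w \in `]0, 1[;
    mu_itv : forall (t : nat) w, (1 <= t)%N -> mu t w \in `]0, 1[;
    mu_measurable : forall t : nat, (1 <= t)%N ->
      measurable_fun [set: g_sigma_algebraType (past_generators p U0 x Y t)]
        (mu t);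
    mu_eq : forall t : nat, (1 <= t)%N -> {ae P, forall w,
      g (mu t w) = alpha + \sum_(i < l) x t i w * beta 0 i
        + \sum_(j < p) phi 0 j *
            (g (Y (t%:Z - j.+1%:Z) w)
             - \sum_(i < l) x (t%:Z - j.+1%:Z) i w * beta 0 i)
        + h (iter t.-1 T (U0 w))};
    (* the conditional law of [Y t] given the past is Beta, stated as the
       defining property of a conditional density *)
    Y_cond_density : forall t : nat, (1 <= t)%N ->
      forall A, <<s past_generators p U0 x Y t >> A ->
      forall B : set R, measurable B ->
        (P (A `&` Y t @^-1` B) =
         \int[P]_(w in A)
           \int[lebesgue_measure]_(y in B) (beta_density nu (mu t w) y)%:E)%E
  }.

End betaARC.

(* Main.v *)
Require Import Defs.
From mathcomp Require Import all_boot all_order all_algebra.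
From mathcomp Require Import all_classical all_reals all_analysis.
From mathcomp Require Import measurable_realfun ring lra zify.
Set Implicit Arguments.
Unset Strict Implicit.
Unset Printing Implicit Defensive.
Import Order.TTheory GRing.Theory Num.Theory.
Import numFieldNormedType.Exports.
Local Open Scope classical_set_scope.
Local Open Scope ring_scope.

(* Only second moments matter: a strong law of large numbers holds for centered
   square integrable X_1, X_2, ... under the two summability conditions.  Let
   S_n be the partial sums, v_i = Var X_i and c_k = sup_t |Cov(X_t, X_{t+k})|.
   Since sum_{k<=n} c_k = O(n^q), a block of n terms has second moment at most
   sum v_i + O(n^(1+q)).  As in the Rademacher-Menshov inequality, for
   n < 2^(m+1) the binary expansion of n writes S_n as a sum of at most m+1
   dyadic blocks, one per level, so that by Cauchy-Schwarz S_n^2 <= W_m, where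
   W_m is m+1 times the sum of the squares of all dyadic blocks in
   ]0, 2^(m+1)].  The expectations E[W_m] / 4^m are summable: the variances
   contribute at most sum_i v_i sum_{2^(m+1) >= i} (m+1)^2 / 4^m, where the inner
   sum is O((ln i)^2 / i^2), and the covariances at most
   sum_m (m+1)^2 2^((q-1)m).  Hence almost surely W_m / 4^m -> 0, and
   (S_n / n)^2 <= W_m / 4^m when 2^m <= n < 2^(m+1). *)

(** * Pathwise inequalities: Cauchy-Schwarz and dyadic chaining *)

Lemma sqr_sum_le (R : realFieldType) (n : nat) (a : nat -> R) :
  (\sum_(i < n) a i) ^+ 2 <= n%:R * \sum_(i < n) a i ^+ 2.
Proof.
elim: n => [|n IH]; first by rewrite !big_ord0 expr0n mulr0.
rewrite !big_ord_recr /=; move: IH.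
set s := \sum_(i < n) a i; set Q := \sum_(i < n) a i ^+ 2 => IH.
case: n @s @Q IH => [|n] s Q IH.
  by rewrite /s /Q !big_ord0 !add0r mul1r.
have n0 : 0 < n.+1%:R :> R by rewrite ltr0n.
have : 0 <= (s - n.+1%:R * a n.+1) ^+ 2 by rewrite sqr_ge0.
rewrite -(natr1 n.+1); set N : R := n.+1%:R in IH n0 * => h.
rewrite -subr_ge0 -(pmulr_rge0 _ n0).
(* After multiplication by [N], the new gap is [N + 1] times the old one plus a square. *)
have -> : N * ((N + 1) * (Q + a n.+1 ^+ 2) - (s + a n.+1) ^+ 2) =
  (N * Q - s ^+ 2) * (N + 1) + (s - N * a n.+1) ^+ 2 by ring.
by rewrite addr_ge0// mulr_ge0 ?subr_ge0// addr_ge0// ltW.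
Qed.

Lemma dyadic_chaining (R : realFieldType) (S : nat -> R) (m n : nat) :
  S 0%N = 0 -> (n < 2 ^ m.+1)%N ->
  S n ^+ 2 <= m.+1%:R * \sum_(j < m.+1) \sum_(b < 2 ^ (m.+1 - j))
                (S (b.+1 * 2 ^ j)%N - S (b * 2 ^ j)%N) ^+ 2.
Proof.
(* [u j] is [S] at [n] with its [j] lowest binary digits cleared. *)
move=> S0 nm; pose u j := S (n %/ 2 ^ j * 2 ^ j)%N.
have -> : S n = \sum_(j < m.+1) (u j - u j.+1).
  rewrite -(big_mkord xpredT (fun j => u j - u j.+1)).
  rewrite (telescope_sumr_eq (fun j => - u j))//; last first.
    by move=> i _; rewrite opprK addrC.
  by rewrite /u divn_small// mul0n S0 expn0 divn1 muln1 oppr0 add0r opprK.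
apply: le_trans (sqr_sum_le _ (fun j => u j - u j.+1)) _.
rewrite ler_wpM2l ?ler0n//; apply: ler_sum => -[j /= jm] _.
have -> : u j.+1 = S ((n %/ 2 ^ j - odd (n %/ 2 ^ j)) * 2 ^ j)%N.
  rewrite /u expnS [(2 * _)%N]mulnC divnMA; congr S.
  rewrite mulnA mulnAC; congr muln.
  by rewrite divn2 muln2 -[(_ %/ _)%N in X in (X - _)%N]odd_double_half addKn.
rewrite /u; set c := (n %/ 2 ^ j)%N.
have cm : (c < 2 ^ (m.+1 - j))%N.
  by rewrite /c ltn_divLR ?expn_gt0// -expnD subnK// ltnW.
(* If the binary digit of [n] at level [j] is 0, then [u j = u j.+1]. If it is 1, then
   [u j - u j.+1] is the increment over block [c.-1], one term of the inner sum. *)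
have [oc|oc] := boolP (odd c); last first.
  by rewrite subn0 subrr expr0n; apply: sumr_ge0 => i _; rewrite sqr_ge0.
have c0 : (0 < c)%N by case: (c) oc.
have cm' : (c.-1 < 2 ^ (m.+1 - j))%N by lia.
rewrite (bigD1 (Ordinal cm'))//= prednK// subn1.
by rewrite lerDl; apply: sumr_ge0 => i _; rewrite sqr_ge0.
Qed.

(** * Weights of the dyadic levels *)

(** Each of the [m.+1] powers [t ^+ i] with [i <= m] is at least [t ^+ m], and their sum is at most
    that of the geometric series. *)
Lemma natS_mul_expr_le (R : realFieldType) (t : R) (m : nat) :
  0 <= t < 1 -> m.+1%:R * t ^+ m <= (1 - t)^-1.
Proof.
move=> /andP[t0 t1]; have t1' : 0 < 1 - t by rewrite subr_gt0.
rewrite -[leRHS]mul1r ler_pdivlMr//.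
apply: (@le_trans _ _ ((\sum_(i < m.+1) t ^+ i) * (1 - t))).
  apply: ler_wpM2r; first exact: ltW.
  rewrite mulr_natl -[m.+1 in leLHS]card_ord -sumr_const.
  apply: ler_sum => i _; apply: ler_wiXn2l => //; first exact: ltW.
  by rewrite -ltnS.
by rewrite mulrC -opprB mulNr -subrX1 opprB gerBl exprn_ge0.
Qed.

Lemma sqr_geometric_bounded (R : rcfType) (t : R) : 0 <= t < 1 ->
  exists K : R, 0 <= K /\
    forall n, \sum_(m < n) m.+1%:R ^+ 2 * t ^+ m <= K.
Proof.
move=> /andP[t0 t1]; set s := Num.sqrt (Num.sqrt t).
(* Two factors [s ^+ m] absorb [m.+1 ^ 2] and the other two stay summable. *)
have s4 : s ^+ 4 = t by rewrite (exprM s 2 2) !sqr_sqrtr ?sqrtr_ge0.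
have s0 : 0 <= s by rewrite sqrtr_ge0.
have s1 : s < 1 by rewrite -[ltRHS]sqrtr1 ltr_sqrt// -[ltRHS]sqrtr1 ltr_sqrt.
have s21 : s ^+ 2 < 1 by rewrite exprn_ilt1.
exists ((1 - s)^-1 ^+ 2 * (1 - s ^+ 2)^-1); split=> [|n].
  by rewrite mulr_ge0 ?sqr_ge0// invr_ge0 subr_ge0 ltW.
apply: (@le_trans _ _ (\sum_(m < n) (1 - s)^-1 ^+ 2 * (s ^+ 2) ^+ m)).
  apply: ler_sum => m _; rewrite -[in leLHS]s4 (_ : _ * _ =
    (m.+1%:R * s ^+ m) ^+ 2 * (s ^+ 2) ^+ m); last first.
    rewrite (exprAC s 4) (exprAC s 2); ring.
  apply: ler_wpM2r; first by rewrite !exprn_ge0.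
  by rewrite lerXn2r ?nnegrE ?natS_mul_expr_le ?s0 ?mulr_ge0 ?ler0n ?exprn_ge0//
    invr_ge0 subr_ge0 ltW.
rewrite -mulr_sumr ler_wpM2l ?sqr_ge0//.
have s2 : 0 < 1 - s ^+ 2 by rewrite subr_gt0.
rewrite -[leRHS]mul1r ler_pdivlMr// mulrC -opprB mulNr -subrX1 opprB gerBl.
by rewrite !exprn_ge0.
Qed.

(** Only levels [m >= e := trunc_log 2 i] contribute. Writing [m = e + m'], the bound
    [e + m' + 1 <= (e + 1) * (m' + 1)] factors the weight at [e] out of the tail; [K] bounds what
    remains. *)
Lemma dyadic_tail_weight_le (R : rcfType) : exists K : R, 0 <= K /\
  forall n i, \sum_(m < n | (i < 2 ^ m.+1)%N) m.+1%:R ^+ 2 * 4^-1 ^+ m <=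
     K * ((trunc_log 2 i).+1%:R ^+ 2 * 4^-1 ^+ trunc_log 2 i).
Proof.
have [|K [K0 HK]] := @sqr_geometric_bounded R 4^-1.
  by rewrite invr_ge0 invf_lt1//; lra.
exists K; split=> // n i; set e := trunc_log 2 i.
have eP m : (i < 2 ^ m.+1)%N -> (e <= m)%N.
  case: i @e => [|i] e im; first by rewrite /e trunc_log0.
  rewrite -ltnS -(@ltn_exp2l 2)//; exact: leq_ltn_trans (trunc_logP _ _) im.
have a0 (m : nat) : 0 <= 4^-1 ^+ m :> R by rewrite exprn_ge0// invr_ge0.
(* The range is lengthened to [e + n] so that it can be cut at [e], where the first [e] terms
   vanish. *)
apply: (@le_trans _ _ (\sum_(m < e + n | (i < 2 ^ m.+1)%N)
    m.+1%:R ^+ 2 * 4^-1 ^+ m)).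
  rewrite addnC big_split_ord /= lerDl; apply: sumr_ge0 => m _.
  by rewrite mulr_ge0 ?sqr_ge0.
rewrite big_split_ord /= big1 ?add0r; last first.
  by move=> m /eP; rewrite leqNgt ltn_ord.
apply: (@le_trans _ _ (\sum_(m < n) e.+1%:R ^+ 2 * 4^-1 ^+ e *
    (m.+1%:R ^+ 2 * 4^-1 ^+ m))); last first.
  rewrite -mulr_sumr mulrC; apply: ler_wpM2r; last exact: HK.
  by rewrite mulr_ge0 ?sqr_ge0.
rewrite big_mkcond /=; apply: ler_sum => m _; case: ifP => _; last first.
  by rewrite !mulr_ge0 ?sqr_ge0.
rewrite (exprD _ e m) [leRHS]mulrACA; apply: ler_wpM2r; first exact: mulr_ge0.
rewrite -exprMn -natrM.
by rewrite lerXn2r ?nnegrE ?ler0n// ler_nat; lia.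
Qed.

(** With [2 ^ e <= i < 2 ^ (e + 1)], both [e * ln 2] and [ln 2] are at most [ln (i + 1)], and
    [(i + 1) ^ 2 <= 4 * 4 ^ e]; hence 16 = 2 ^ 2 * 4. At [i = 0] the right side would be 0 and the
    left side 1. *)
Lemma trunc_log_weight_le (R : realType) (i : nat) : (0 < i)%N ->
  (trunc_log 2 i).+1%:R ^+ 2 * 4^-1 ^+ trunc_log 2 i <=
    16 / ln 2 ^+ 2 * (ln i.+1%:R ^+ 2 / i.+1%:R ^+ 2) :> R.
Proof.
move=> i0; set e := trunc_log 2 i.
have ln20 : 0 < ln 2 :> R by rewrite ln_gt0 ?ltr1n.
have lni : e.+1%:R * ln 2 <= 2 * ln i.+1%:R :> R.
  rewrite -[e.+1%:R]natr1 mulrDl mul1r [leRHS]mulr_natl [leRHS]mulr2n lerD//.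
    rewrite mulr_natl -lnXn// ler_ln ?posrE ?exprn_gt0// -natrX ler_nat.
    by rewrite (leq_trans (trunc_logP _ i0)).
  by rewrite ler_ln ?posrE// ler_nat.
have ei : 4^-1 ^+ e <= 4 / i.+1%:R ^+ 2 :> R.
  rewrite exprVn ler_pdivlMr ?exprn_gt0// mulrC ler_pdivrMr ?exprn_gt0//.
  rewrite -exprS (_ : 4 = 2 ^+ 2) -?natrX ?ler_nat//.
  by rewrite expnAC leq_sqr; exact: trunc_log_ltn.
rewrite [leRHS](_ : _ = ((2 * ln i.+1%:R) / ln 2) ^+ 2 * (4 / i.+1%:R ^+ 2)); last first.
  by field; rewrite nat1r pnatr_eq0 lt0r_neq0.
apply: ler_pM => //; rewrite ?sqr_ge0 ?exprn_ge0 ?invr_ge0//.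
rewrite lerXn2r ?nnegrE ?ler0n//; last by rewrite ler_pdivlMr.
by rewrite divr_ge0 ?mulr_ge0 ?ln_ge0 ?ler1n// ltW.
Qed.

(** Exchanging the sums gives each [v i] a dyadic tail as its weight, which is comparable to the
    logarithmic weight for [i > 0]. *)
Lemma sum_dyadic_weights_bounded (R : realType) (v : nat -> R) (B : R) :
  (forall k, 0 <= v k) ->
  (forall n, \sum_(i < n) v i * (ln i.+1%:R ^+ 2 / i.+1%:R ^+ 2) <= B) ->
  exists K : R, forall n,
    \sum_(m < n) m.+1%:R ^+ 2 * 4^-1 ^+ m * \sum_(i < 2 ^ m.+1) v i <= K.
Proof.
move=> v0 vB; have [K [K0 HK]] := dyadic_tail_weight_le R.
exists (K * v 0%N + K * (16 / ln 2 ^+ 2) * B) => n.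
apply: (@le_trans _ _ (\sum_(i < (2 ^ n).+1) v i *
    \sum_(m < n | (i < 2 ^ m.+1)%N) m.+1%:R ^+ 2 * 4^-1 ^+ m)).
  under [leRHS]eq_bigr do rewrite mulr_sumr.
  rewrite (exchange_big_dep xpredT)//=; apply: ler_sum => m _.
  under [leRHS]eq_bigr do rewrite mulrC.
  rewrite -mulr_sumr ler_wpM2l ?mulr_ge0 ?sqr_ge0 ?exprn_ge0 ?invr_ge0//.
  rewrite (big_ord_widen (2 ^ n).+1 (fun i => v i))//.
  by apply: leq_trans (leqnSn _); rewrite leq_exp2l.
have lnw0 i : 0 <= ln i.+1%:R ^+ 2 / i.+1%:R ^+ 2 :> R.
  by rewrite divr_ge0 ?sqr_ge0.
have ln20 : 0 <= 16 / ln 2 ^+ 2 :> R by rewrite divr_ge0 ?sqr_ge0.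
(* The index 0 is treated apart: its logarithmic weight is [ln 1 = 0], so [B] does not control
   [v 0]. *)
rewrite big_ord_recl /=; apply: lerD.
  rewrite mulrC ler_wpM2r//; apply: le_trans (HK n 0%N) _.
  by rewrite trunc_log0 expr1n expr0 !mulr1.
rewrite -mulrA; apply: (@le_trans _ _ (K * (16 / ln 2 ^+ 2 *
   \sum_(i < (2 ^ n).+1) v i * (ln i.+1%:R ^+ 2 / i.+1%:R ^+ 2)))); last first.
  by rewrite !ler_wpM2l.
rewrite mulrA mulr_sumr big_ord_recl /= -[leLHS]add0r lerD//.
  by apply: mulr_ge0; apply: mulr_ge0.
apply: ler_sum => i _; rewrite mulrCA ler_wpM2l//.
apply: le_trans (HK _ _) _; rewrite -[leRHS]mulrA ler_wpM2l//.
exact: trunc_log_weight_le.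
Qed.

(** * Integration of sums and almost everywhere convergence *)

Lemma Rintegral_sum d (T : measurableType d) (R : realType)
    (mu : {measure set T -> \bar R}) (I : Type) (s : seq I) (f : I -> T -> R) :
  (forall i, mu.-integrable setT (EFin \o f i)) ->
  \int[mu]_w (\sum_(i <- s) f i w) = \sum_(i <- s) \int[mu]_w f i w.
Proof.
move=> fi; elim: s => [|i s IH].
  by rewrite big_nil /Rintegral integral0_eq// => w _; rewrite big_nil.
rewrite big_cons -IH -RintegralD//.
  by apply: eq_Rintegral => w _; rewrite big_cons.
rewrite (_ : _ \o _ = fun w => (\sum_(i <- s) (f i w)%:E)%E).
  by apply: (@integrable_sum _ _ _ _ _ _ _ s xpredT (fun i => EFin \o f i)) => //.
by apply/funext => w /=; rewrite sumEFin.
Qed.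

(** By monotone convergence the sum of the [Z m] is integrable, hence finite almost everywhere, and
    the terms of a convergent series tend to 0. *)
Lemma ae_cvg0_of_summable_integral d (T : measurableType d) (R : realType)
    (mu : {measure set T -> \bar R}) (Z : nat -> T -> R) (K : R) :
  (forall m, mu.-integrable setT (EFin \o Z m)) ->
  (forall m w, 0 <= Z m w) ->
  (forall n, \sum_(m < n) \int[mu]_w Z m w <= K) ->
  {ae mu, forall w, Z m w @[m --> \oo] --> (0 : R)}.
Proof.
move=> iZ Z0 ZK; pose g w := (\sum_(0 <= m <oo) (Z m w)%:E)%E.
have mZ m : measurable_fun setT (Z m).
  by apply/measurable_EFinP; exact: measurable_int (iZ m).
have g_fin : (\int[mu]_w g w < +oo)%E.
  rewrite /g integral_nneseries; [|by []|by move=> m; exact/measurable_EFinP|];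
    last by move=> m w _; rewrite lee_fin.
  apply: le_lt_trans (ltry K); apply: lime_le.
    by apply: is_cvg_nneseries => m _ _; apply: integral_ge0 => w _; rewrite lee_fin.
  apply: nearW => n; rewrite big_mkord.
  apply: le_trans (_ : ((\sum_(m < n) \int[mu]_w Z m w)%:E <= _)%E); last by rewrite lee_fin.
  rewrite -sumEFin; apply: lee_sum => m _.
  by rewrite /Rintegral fineK ?lexx//; exact: (integrable_fin_num _ (iZ m)).
have ig : mu.-integrable setT g.
  apply/integrableP; split.
    apply: ge0_emeasurable_sum => [m w _ _|m _]; first by rewrite lee_fin.
    exact/measurable_EFinP.
  under eq_integral.
    move=> w _; rewrite gee0_abs; last by apply: nneseries_ge0 => m _ _; rewrite lee_fin.
    over.
  exact: g_fin.
apply: filterS (integrable_ae measurableT ig) => w /(_ I) gw.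
apply: cvg_series_cvg_0; apply: nondecreasing_is_cvgn.
  by apply: nondecreasing_series => m _ _.
exists (fine (g w)) => _ [n _ <-]; rewrite -lee_fin fineK// /series /= -sumEFin.
by apply: nneseries_lim_ge => m _ _; rewrite lee_fin.
Qed.

(** * Second moments of blocks *)

Section second_moments.
Context d (T : measurableType d) (R : realType) (P : probability T R).

Lemma Lfun2_sum (n : nat) (X : nat -> T -> R) :
  (forall i, X i \in Lfun P 2%:E) -> (fun w => \sum_(i < n) X i w) \in Lfun P 2%:E.
Proof.
move=> LX; rewrite [X in X \in _](_ : _ = \sum_(i < n) X i).
  by rewrite rpred_sum ?lee1n.
by rewrite fct_sumE.
Qed.

Lemma integrable_Lfun2M (X Y : T -> R) : X \in Lfun P 2%:E -> Y \in Lfun P 2%:E ->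
  P.-integrable setT (EFin \o (fun w => X w * Y w)).
Proof. by move=> LX LY; apply/Lfun1_integrable; exact: Lfun2_mul_Lfun1. Qed.

(** By induction on [n]: a new last term adds its own second moment and twice its cross moments with
    the earlier terms, one for each lag from 1 to [n]. *)
Lemma sqr_sum_moment_le (X : nat -> T -> R) (c : nat -> R) (a n : nat) :
  (forall i, X i \in Lfun P 2%:E) ->
  (forall k, 0 <= c k) ->
  (forall i k, (0 < k)%N -> \int[P]_w (X i w * X (i + k)%N w) <= c k) ->
  \int[P]_w ((\sum_(i < n) X (a + i)%N w) ^+ 2) <=
    \sum_(i < n) \int[P]_w (X (a + i)%N w ^+ 2) +
      2 * n%:R * \sum_(k < n) c k.+1.
Proof.
move=> LX c0 Xc; elim: n => [|n IH].
  rewrite /Rintegral integral0_eq => [|w _]; last by rewrite big_ord0 expr0n.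
  by rewrite !big_ord0 mulr0 addr0.
pose S w := \sum_(i < n) X (a + i)%N w; pose Y := X (a + n)%N.
have LS : S \in Lfun P 2%:E by exact: (@Lfun2_sum n (fun i => X (a + i)%N)).
have iSY := integrable_Lfun2M LS (LX (a + n)%N).
have iSS := Lfun2_integrable_sqr LS.
have iYY := Lfun2_integrable_sqr (LX (a + n)%N).
have iSY2 : P.-integrable setT (EFin \o (fun w => 2 * (S w * Y w))).
  exact: (integrableZl measurableT 2 iSY).
have -> : \int[P]_w ((\sum_(i < n.+1) X (a + i)%N w) ^+ 2) =
    \int[P]_w (S w ^+ 2) + 2 * \int[P]_w (S w * Y w) + \int[P]_w (Y w ^+ 2).
  rewrite -RintegralZl// -!RintegralD//.
  - by apply: eq_Rintegral => w _; rewrite big_ord_recr /= -/(S w) -/(Y w); ring.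
  - exact: (integrableD measurableT iSS iSY2).
have SY : \int[P]_w (S w * Y w) <= \sum_(k < n) c k.+1.
  have -> : \int[P]_w (S w * Y w) =
      \sum_(i < n) \int[P]_w (X (a + i)%N w * X (a + n)%N w).
    rewrite -Rintegral_sum; last by move=> i; exact: integrable_Lfun2M.
    by apply: eq_Rintegral => w _; rewrite /S mulr_suml.
  (* The term of index [i] lies at lag [n - i] from the new one, so the sum over lags is
     reversed. *)
  rewrite [leRHS](reindex_inj rev_ord_inj) /=; apply: ler_sum => i _.
  have -> : (a + n = a + i + (n - i.+1).+1)%N by have := ltn_ord i; lia.
  exact: Xc.
rewrite !big_ord_recr /= -/Y.
rewrite -[n.+1%:R]natr1.
have N0 : 0 <= n%:R :> R by [].
have cn := c0 n.+1.
have Nc : 0 <= n%:R * c n.+1 by rewrite mulr_ge0.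
move: IH SY; rewrite -/S; move: (\sum_(k < n) c k.+1) => G IH SY.
by lra.
Qed.

End second_moments.

(** * The strong law for weakly correlated sequences *)

Lemma sum_le_powR (R : realType) (c : nat -> R) (q C : R) (n : nat) :
  0 <= q -> (forall k, 0 <= c k) ->
  \sum_(k < n) c k.+1 / k.+1%:R `^ q <= C ->
  \sum_(k < n) c k.+1 <= C * n%:R `^ q.
Proof.
move=> q0 c0 cC; apply: le_trans (_ : (\sum_(k < n) c k.+1 / k.+1%:R `^ q) *
    n%:R `^ q <= _); last by rewrite ler_wpM2r ?powR_ge0.
rewrite mulr_suml; apply: ler_sum => k _.
have k0 : 0 < k.+1%:R `^ q :> R by rewrite powR_gt0.
rewrite mulrAC ler_pdivlMr// ler_wpM2l// ge0_ler_powR ?nnegrE//.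
by rewrite ler_nat.
Qed.

Lemma big_ord_mul_split (V : nmodType) (f : nat -> V) (m n : nat) :
  \sum_(i < m * n) f i = \sum_(b < m) \sum_(i < n) f (b * n + i)%N.
Proof.
elim: m => [|m IH]; first by rewrite !big_ord0.
by rewrite mulSnr big_split_ord /= IH big_ord_recr.
Qed.

(* [X i] plays the role of the term of time [i.+1]. *)
Section strong_law.
Context d (T : measurableType d) (R : realType) (P : probability T R).
Variables (X : nat -> T -> R) (c : nat -> R) (q C B : R).
Hypothesis LX : forall i, X i \in Lfun P 2%:E.
Hypothesis q01 : 0 <= q < 1.
Hypothesis c0 : forall k, 0 <= c k.
Hypothesis cov_le : forall i k, (0 < k)%N ->
  \int[P]_w (X i w * X (i + k)%N w) <= c k.
Hypothesis sum_cov_le : forall n, \sum_(k < n) c k.+1 / k.+1%:R `^ q <= C.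
Hypothesis sum_var_le : forall n,
  \sum_(i < n) \int[P]_w (X i w ^+ 2) * (ln i.+1%:R ^+ 2 / i.+1%:R ^+ 2) <= B.

Let S n w := \sum_(i < n) X i w.
Let v i := \int[P]_w (X i w ^+ 2).
(** This is W_m / 4^m, the bound for [(S n / n) ^+ 2] when [2 ^ m <= n < 2 ^ m.+1]. *)
Let Z (m : nat) w := 4^-1 ^+ m * (m.+1%:R * \sum_(j < m.+1)
  \sum_(b < 2 ^ (m.+1 - j)) (S (b.+1 * 2 ^ j)%N w - S (b * 2 ^ j)%N w) ^+ 2).

Let v_ge0 i : 0 <= v i.
Proof. by apply: Rintegral_ge0 => w _; rewrite sqr_ge0. Qed.

Let C_ge0 : 0 <= C.
Proof. by have := sum_cov_le 0; rewrite big_ord0. Qed.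

Let Z_ge0 m w : 0 <= Z m w.
Proof.
rewrite mulr_ge0 ?exprn_ge0// mulr_ge0//; apply: sumr_ge0 => j _.
by apply: sumr_ge0 => b _; rewrite sqr_ge0.
Qed.

Let blockE b n w : S (b.+1 * n)%N w - S (b * n)%N w =
  \sum_(i < n) X (b * n + i)%N w.
Proof. by rewrite /S mulSnr big_split_ord /= addrAC subrr add0r. Qed.

Let integrable_block b n :
  P.-integrable setT (EFin \o (fun w => (S (b.+1 * n)%N w - S (b * n)%N w) ^+ 2)).
Proof.
under eq_fun do rewrite blockE.
apply: Lfun2_integrable_sqr.
exact: (@Lfun2_sum _ _ _ P n (fun i => X (b * n + i)%N)).
Qed.

Let integrable_level m j : P.-integrable setT (EFin \o (fun w =>
  \sum_(b < m) (S (b.+1 * j)%N w - S (b * j)%N w) ^+ 2)).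
Proof.
rewrite (_ : _ \o _ = fun w => (\sum_(b < m)
    ((S (b.+1 * j)%N w - S (b * j)%N w) ^+ 2)%:E)%E).
  apply: (@integrable_sum _ _ _ _ _ _ _ (index_enum 'I_m) xpredT
    (fun (b : 'I_m) => EFin \o (fun w => (S (b.+1 * j)%N w - S (b * j)%N w) ^+ 2))) => //.
by apply/funext => w /=; rewrite sumEFin.
Qed.

Let integrable_levels m : P.-integrable setT (EFin \o (fun w =>
  \sum_(j < m.+1) \sum_(b < 2 ^ (m.+1 - j))
    (S (b.+1 * 2 ^ j)%N w - S (b * 2 ^ j)%N w) ^+ 2)).
Proof.
rewrite (_ : _ \o _ = fun w => (\sum_(j < m.+1) (\sum_(b < 2 ^ (m.+1 - j))
    (S (b.+1 * 2 ^ j)%N w - S (b * 2 ^ j)%N w) ^+ 2)%:E)%E).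
  apply: (@integrable_sum _ _ _ _ _ _ _ (index_enum 'I_m.+1) xpredT
    (fun (j : 'I_m.+1) => EFin \o (fun w => \sum_(b < 2 ^ (m.+1 - j))
    (S (b.+1 * 2 ^ j)%N w - S (b * 2 ^ j)%N w) ^+ 2))) => //.
by apply/funext => w /=; rewrite sumEFin.
Qed.

Let integrable_Z m : P.-integrable setT (EFin \o Z m).
Proof.
have := integrableZl measurableT (4^-1 ^+ m)
  (integrableZl measurableT m.+1%:R (integrable_levels m)).
by apply: eq_integrable => // w _ /=.
Qed.

(** Factor by which the bound on the covariance sums grows when the block length doubles. It is
    below 2 because [q < 1], so that [rho / 2] is a summable ratio. *)
Let rho : R := 2 `^ q.

Let rho_ge1 : 1 <= rho.
Proof. by case/andP: q01 => q0 _; rewrite -(powRr0 2) ler_powR// ler1n. Qed.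

Let rho_lt2 : rho < 2.
Proof.
case/andP: q01 => _ q1; rewrite /rho /powR pnatr_eq0 /=.
by rewrite -[ltRHS]lnK ?posrE// ltr_expR gtr_pMl// ln_gt0// ltr1n.
Qed.

(** The blocks of one level partition the first [2 ^ m.+1] indices, so their variances add up to the
    full sum. Each of the [2 ^ (m.+1 - j)] blocks has covariance part at most
    [2 * 2 ^ j * C * rho ^ m], as [(2 ^ j) ^ q = rho ^ j]. *)
Let level_le m j : (j <= m)%N ->
  \int[P]_w (\sum_(b < 2 ^ (m.+1 - j))
     (S (b.+1 * 2 ^ j)%N w - S (b * 2 ^ j)%N w) ^+ 2) <=
  \sum_(i < 2 ^ m.+1) v i + 4 * C * 2 ^+ m * rho ^+ m.
Proof.
move=> jm; have j_le := leqW jm.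
rewrite Rintegral_sum; last by move=> b; exact: integrable_block.
apply: (@le_trans _ _ (\sum_(b < 2 ^ (m.+1 - j))
    (\sum_(i < 2 ^ j) v (b * 2 ^ j + i)%N + 2 * 2 ^+ j * (C * rho ^+ m)))).
  apply: ler_sum => b _; under eq_Rintegral do rewrite blockE.
  apply: le_trans (sqr_sum_moment_le _ _ LX c0 cov_le) _.
  rewrite lerD2l natrX ler_wpM2l ?mulr_ge0 ?exprn_ge0//.
  apply: le_trans (sum_le_powR (proj1 (andP q01)) c0 (sum_cov_le _)) _.
  rewrite ler_wpM2l// natrX -powR_mulrn// -powRrM mulrC powRrM powR_mulrn//.
  by rewrite ler_weXn2l.
rewrite big_split /= -big_ord_mul_split -expnD subnK// lerD2l.
have e2 : 2 ^+ (m.+1 - j) * 2 ^+ j = 2 * 2 ^+ m :> R by rewrite -exprD subnK// exprS.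
rewrite sumr_const card_ord -[leLHS]mulr_natl natrX le_eqVlt; apply/orP; left.
by apply/eqP; transitivity ((2 ^+ (m.+1 - j) * 2 ^+ j) * (2 * (C * rho ^+ m)));
  [|rewrite e2]; ring.
Qed.

(** One factor [m.+1] comes from Cauchy-Schwarz and the other from the number of levels;
    [2 ^ m * rho ^ m / 4 ^ m] is [(rho / 2) ^ m]. *)
Let integral_Z_le m : \int[P]_w Z m w <=
  m.+1%:R ^+ 2 * 4^-1 ^+ m * (\sum_(i < 2 ^ m.+1) v i) +
  4 * C * (m.+1%:R ^+ 2 * (rho / 2) ^+ m).
Proof.
have iL := integrable_levels m.
rewrite RintegralZl//; last exact: (integrableZl measurableT m.+1%:R iL).
rewrite RintegralZl// Rintegral_sum; last by move=> j; exact: integrable_level.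
set V := \sum_(i < _) v i.
apply: (@le_trans _ _ (4^-1 ^+ m * (m.+1%:R * \sum_(j < m.+1)
    (V + 4 * C * 2 ^+ m * rho ^+ m)))).
  rewrite !ler_wpM2l ?exprn_ge0//; apply: ler_sum => j _.
  by apply: level_le; rewrite -ltnS.
rewrite sumr_const card_ord -[_ *+ m.+1]mulr_natl (exprMn m rho).
rewrite (_ : 2^-1 ^+ m = 4^-1 ^+ m * 2 ^+ m :> R); last first.
  by rewrite -exprMn; congr (_ ^+ _); lra.
by rewrite le_eqVlt; apply/orP; left; apply/eqP; ring.
Qed.

Let sqr_mean_le n w : (0 < n)%N ->
  (n%:R^-1 * S n w) ^+ 2 <= Z (trunc_log 2 n) w.
Proof.
move=> n0; set m := trunc_log 2 n.
rewrite exprMn ler_pM ?sqr_ge0//.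
  rewrite exprVn exprVn lef_pV2 ?posrE ?exprn_gt0 ?ltr0n//.
  rewrite -!natrX ler_nat (_ : 4 = 2 ^ 2)%N// expnAC leq_sqr.
  exact: trunc_logP.
apply: (@dyadic_chaining R (S ^~ w)); first by rewrite /S big_ord0.
exact: trunc_log_ltn.
Qed.

Lemma strong_law_weakly_correlated :
  {ae P, forall w, (fun n : nat => n%:R^-1 * \sum_(i < n) X i w) @ \oo --> (0 : R)}.
Proof.
have [|K1 HK1] := @sum_dyadic_weights_bounded R v B v_ge0; first exact: sum_var_le.
have [|K2 [_ HK2]] := @sqr_geometric_bounded R (rho / 2).
  have := rho_ge1; have := rho_lt2; move: rho => r *; lra.
have ZK n : \sum_(m < n) \int[P]_w Z m w <= K1 + 4 * C * K2.
  apply: le_trans (ler_sum _ (fun (m : 'I_n) _ => integral_Z_le m)) _.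
  by rewrite big_split lerD ?HK1//= -mulr_sumr ler_wpM2l ?mulr_ge0// HK2.
apply: filterS (ae_cvg0_of_summable_integral integrable_Z Z_ge0 ZK) => w Zw.
apply/cvgrPdist_lt => e e0.
have e20 : 0 < e ^+ 2 by rewrite exprn_gt0.
have /cvgrPdist_lt/(_ _ e20)[M _ HM] := Zw.
(* From [n >= 2 ^ M] on, the level [trunc_log 2 n] is at least [M]. *)
exists (2 ^ M)%N => // n /= Mn.
have n0 : (0 < n)%N by apply: leq_trans Mn; rewrite expn_gt0.
rewrite sub0r normrN -ltr_sqr ?nnegrE ?(ltW e0)// real_normK ?num_real//.
apply: le_lt_trans (sqr_mean_le w n0) _.
have := HM (trunc_log 2 n) _; rewrite /= sub0r normrN ger0_norm ?Z_ge0//.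
by apply; apply: trunc_log_max.
Qed.

End strong_law.

(** * Reduction of the theorem to the strong law for real sequences *)

(** Passes from extended real series starting at 1 to real partial sums starting at 0: nonnegative
    partial sums stay below the total, which forces every term to be finite. *)
Lemma nneseries1_finite (R : realType) (u : nat -> \bar R) :
  (forall k, (0 <= u k)%E) -> (\sum_(1 <= k <oo) u k < +oo)%E ->
  (forall k, (0 < k)%N -> u k \is a fin_num) /\
  forall n, \sum_(k < n) fine (u k.+1) <= fine (\sum_(1 <= k <oo) u k)%E.
Proof.
move=> u0 us; have us_fin : (\sum_(1 <= k <oo) u k)%E \is a fin_num.
  by rewrite ge0_fin_numE// nneseries_ge0.
have partial n : (\sum_(k < n) u k.+1 <= \sum_(1 <= k <oo) u k)%E.
  rewrite -(big_mkord xpredT (fun k => u k.+1)) -(big_add1 _ _ 0 n.+1 xpredT u).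
  exact: nneseries_lim_ge.
have u_fin k : (0 < k)%N -> u k \is a fin_num.
  case: k => // k _; rewrite ge0_fin_numE//; apply: le_lt_trans us.
  apply: le_trans (partial k.+1); rewrite big_ord_recr /= leeDr//.
  exact: sume_ge0.
split=> // n; rewrite -lee_fin fineK// -sumEFin; apply: le_trans (partial n).
by apply: lee_sum => k _; rewrite fineK ?u_fin.
Qed.

Lemma Lfun2_of_sqr d (T : measurableType d) (R : realType)
    (P : probability T R) (f : T -> R) :
  measurable_fun setT f -> ('E_P[fun w => (f w ^+ 2)%R] < +oo)%E ->
  f \in Lfun P 2%:E.
Proof.
rewrite [in X in _ -> X -> _]unlock => mf f2; rewrite inE; apply/andP.
split; rewrite inE//=.
rewrite /finite_norm unlock poweR_lty//=; apply: le_lt_trans f2.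
rewrite le_eqVlt; apply/orP; left; apply/eqP; apply: eq_integral => w _.
by rewrite powR_mulrn// real_normK// num_real.
Qed.

Lemma fine_covarianceE d (T : measurableType d) (R : realType)
    (P : probability T R) (f g : T -> R) :
  fine (covariance P f g) =
  \int[P]_w ((f w - fine 'E_P[f]) * (g w - fine 'E_P[g])).
Proof.
have E X : fine 'E_P[X] = \int[P]_w X w by rewrite unlock.
by rewrite covariance.unlock [LHS]E.
Qed.

Theorem theorem2p3 (d : measure_display) (Omega : measurableType d)
    (R : realType) (P : probability Omega R)
    (p l : nat) (nu alpha : R) (beta : 'rV[R]_l) (phi : 'rV[R]_p)
    (x : int -> 'I_l -> {RV P >-> R}) (T : R -> R) (U0 : {RV P >-> R})
    (g h : R -> R) (mu : nat -> Omega -> R) (Y : int -> {RV P >-> R})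
    (hY : betaARC nu alpha beta phi x T U0 g h mu Y)
    (vphi : R -> R) (vphi_meas : measurable_fun (`[0, 1]%classic : set R) vphi)
    (vphi_L2 : forall t : nat, (0 < t)%N ->
       ('E_P[fun w => (vphi (Y t w) ^+ 2)%R] < +oo)%E)
    (cov_summable : exists q : R, [/\ 0 <= q, q < 1 &
       (\sum_(1 <= k <oo)
          ereal_sup [set `|covariance P (vphi \o Y t) (vphi \o Y (t + k)%N)|
                    | t in [set t : nat | (1 <= t)%N]]
          * ((k%:R `^ q)^-1)%R%:E < +oo)%E])
    (var_summable :
       (\sum_(1 <= k <oo)
          'V_P[vphi \o Y k] * (ln k%:R ^+ 2 / k%:R ^+ 2)%:E < +oo)%E) :
  {ae P, forall w,
    (fun n : nat => n%:R^-1 *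
       \sum_(1 <= k < n.+1) (vphi (Y k w) - fine 'E_P[vphi \o Y k]))
    @ \oo --> (0 : R)}.
Proof.
case: cov_summable => q [q0 q1 cov_summable].
have LY (t : nat) : (0 < t)%N -> (vphi \o Y t) \in Lfun P 2%:E.
  move=> t0; apply: Lfun2_of_sqr; last exact: vphi_L2.
  (* Measurability of [vphi] on [0, 1] suffices because [Y t] takes its values in (0, 1), as
     [1 - p <= t]. *)
  apply: (@measurable_comp _ _ _ Omega R R `[0, 1]%classic) vphi_meas _ => //.
  move=> _ [w _ <-] /=; have : 1 - p%:Z <= t%:Z by lia.
  move=> /(Y_itv hY w); rewrite !in_itv /= => /andP[/ltW -> /ltW ->].
  by [].
have EY_cov (t s : nat) : (0 < t)%N -> (0 < s)%N ->
    covariance P (vphi \o Y t) (vphi \o Y s) \is a fin_num.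
  move=> t0 s0; apply: covariance_fin_num.
  - by apply: Lfun_subset12 (LY _ t0); rewrite fin_num_measure.
  - by apply: Lfun_subset12 (LY _ s0); rewrite fin_num_measure.
  - by apply: Lfun2_mul_Lfun1; exact: LY.
pose X i w := vphi (Y i.+1 w) - fine 'E_P[vphi \o Y i.+1].
pose G k := ereal_sup [set `|covariance P (vphi \o Y t) (vphi \o Y (t + k)%N)|%E
                    | t in [set t : nat | (1 <= t)%N]].
have G_ub t k : (0 < t)%N ->
    (`|covariance P (vphi \o Y t) (vphi \o Y (t + k)%N)| <= G k)%E.
  by move=> t0; apply: ereal_sup_ubound; exists t.
have G0 k : (0 <= G k)%E by apply: le_trans (G_ub 1%N k _).
have w0 (k : nat) : (0 < k)%N -> 0 < (k%:R `^ q)^-1 :> R.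
  by move=> k0; rewrite invr_gt0 powR_gt0// ltr0n.
have [|Gw_fin sum_G] := @nneseries1_finite R _ _ cov_summable.
  by move=> k; apply: mule_ge0 (G0 k) _; rewrite lee_fin invr_ge0 powR_ge0.
have G_fin k : (0 < k)%N -> G k \is a fin_num.
  (* An infinite [G k] times its positive weight would be an infinite term of a finite series. *)
  move=> k0; rewrite ge0_fin_numE// ltNge leye_eq; apply/negP => /eqP Gk.
  by have := Gw_fin _ k0; rewrite -/(G k) Gk gt0_mulye// lte_fin w0.
have [|_ sum_V] := @nneseries1_finite R _ _ var_summable.
  by move=> k; rewrite mule_ge0 ?variance_ge0// lee_fin divr_ge0 ?sqr_ge0.
have LX i : X i \in Lfun P 2%:E.
  rewrite (_ : X i = (vphi \o Y i.+1) \- cst (fine 'E_P[vphi \o Y i.+1]))//.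
  by rewrite rpredB ?lee1n//= => _; [exact: LY|exact: Lfun_cst].
have q01 : 0 <= q < 1 by rewrite q0.
(* [G 0], a supremum of variances, may be infinite; [fine] then returns 0, which keeps the sequence
   nonnegative. *)
have c0 k : 0 <= fine (G k) by rewrite fine_ge0.
have cov_le i k : (0 < k)%N -> \int[P]_w (X i w * X (i + k)%N w) <= fine (G k).
  (* The cross moment of the centered variables is the covariance at times [i.+1] and [i.+1 + k], a
     member of the set whose supremum is [G k]. *)
  move=> k0; rewrite -fine_covarianceE.
  apply: le_trans (ler_norm _) _; rewrite -fine_abse ?EY_cov//.
  by rewrite fine_le ?abse_fin_num ?EY_cov ?G_fin//; exact: (G_ub i.+1).
have sum_c n : \sum_(k < n) fine (G k.+1) / k.+1%:R `^ q <=
    fine (\sum_(1 <= k <oo) G k * ((k%:R `^ q)^-1)%:E)%E.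
  apply: le_trans (sum_G n); rewrite le_eqVlt; apply/orP; left; apply/eqP.
  by apply: eq_bigr => k _; rewrite fineM// G_fin.
have sum_v n : \sum_(i < n) \int[P]_w (X i w ^+ 2) *
      (ln i.+1%:R ^+ 2 / i.+1%:R ^+ 2) <=
    fine (\sum_(1 <= k <oo) 'V_P[vphi \o Y k] * (ln k%:R ^+ 2 / k%:R ^+ 2)%:E)%E.
  apply: le_trans (sum_V n); rewrite le_eqVlt; apply/orP; left; apply/eqP.
  apply: eq_bigr => k _; rewrite fineM//; last exact: EY_cov.
  by rewrite /variance fine_covarianceE.
apply: filterS (strong_law_weakly_correlated LX q01 c0 cov_le sum_c sum_v) => w Sw.
by under eq_fun do rewrite big_add1 big_mkord.
Qed.
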